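(* Assume that $\mathbf{M}_{\nu,h}^n$ is symmetric positive definite on $\mathbb{W}_h^n$ and $\mathbf{M}_{\tau,h}^n$ is symmetric positive definite on $\mathbb{R}^N$. The reduced nonlinear system $\bm{R}(\bm{\Xi})=\bm{0}$ of dimension $K+1$ (independent of $N$) is equivalent to the fully discrete algebraic system (both defined in the context), in the following sense. (i) If $\bm{\Xi}=(r,\lambda_1,\dots,\lambda_K)^\top\in\mathbb{R}^{K+1}$ with $r\neq0$ solves $\bm{R}(\bm{\Xi})=\bm{0}$, and one sets $r_{\mathrm g,h}^{n+1}=r$, $\lambda_{i,h}^{n+1}=\lambda_i$, $$r_{\mathrm m,h}^{n+1}=\frac{r_{\mathrm m,h}^n}{1-\frac{\Delta t}{2(S_{\mathrm m,h}^n)^2}(\mathbf{F}_{\mathrm m,h}^n)^\top\mathbf{V}_{\mathrm m,h}^n},\qquad\mathbf{V}_\tau^{n+1}=\frac{r_{\mathrm m,h}^{n+1}}{S_{\mathrm m,h}^n}\mathbf{V}_{\mathrm m,h}^n,\qquad\mathbf{V}_\nu^{n+1}=\frac{r_{\mathrm g,h}^{n+1}}{S_{\mathrm g,h}^n}\mathbf{V}_{\mathrm g,h}^n+\sum_{i=1}^K\lambda_{i,h}^{n+1}\mathbf{V}_{i,h}^n,$$ then all equations of the fully discrete algebraic system are satisfied. (ii) Conversely, for any solution of the fully discrete algebraic system with $r_{\mathrm g,h}^{n+1}\ne0$, the vector $\bm{\Xi}=(r_{\mathrm g,h}^{n+1},\lambda_{1,h}^{n+1},\dots,\lambda_{K,h}^{n+1})^\top$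 satisfies $\bm{R}(\bm{\Xi})=\bm{0}$.
   Context: Let $\Delta t>0$. $\bm{\gamma}_h^n$ is a closed polygon with vertices $\mathbf{x}_1^n,\dots,\mathbf{x}_N^n\in\mathbb{R}^2$, with fixed nodal unit tangents $\bm{\tau}_j^n$ and unit normals $\bm{\nu}_j^n$ (computed from $\bm{\gamma}_h^n$) forming positively oriented orthonormal bases. Given, frozen on $\bm{\gamma}_h^n$: metric matrices $\mathbf{A}_{\nu,h}^n,\mathbf{A}_{\tau,h}^n\in\mathbb{R}^{N\times N}$; stabilization matrices $\mathbf{D}_{\nu,h}^n,\mathbf{D}_{\tau,h}^n\in\mathbb{R}^{N\times N}$ (symmetric positive semi-definite); stabilized matrices $\mathbf{M}_{\nu,h}^n=\mathbf{A}_{\nu,h}^n+\Delta t\,\mathbf{D}_{\nu,h}^n$, $\mathbf{M}_{\tau,h}^n=\mathbf{A}_{\tau,h}^n+\Delta t\,\mathbf{D}_{\tau,h}^n$; load vectors $\mathbf{F}_{\mathrm g,h}^n$ (geometric force), $\mathbf{F}_{\mathrm m,h}^n$ (mesh force), $\mathbf{G}_{1,h}^n,\dots,\mathbf{G}_{K,h}^n$ (constraint gradients) in $\mathbb{R}^N$; positive numbers $S_{\mathrm g,h}^n,S_{\mathrm m,h}^n$ (square roots of shifted geometric and mesh energies of $\bm{\gamma}_h^n$); real constraint functionals $C_1,\dots,C_K$ on closed polygons; and $r_{\mathrm g,h}^n,r_{\mathrm m,h}^n\in\mathbb{R}$. Normal velocity space $\mathbb{W}_h^n$. For the $L^2$ normal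 metric $\mathbb{W}_h^n=\mathbb{R}^N$. For the $H^{-1}$ normal metric $\mathbb{W}_h^n=\{\mathbf{u}\in\mathbb{R}^N:(\mathbf{m}^n)^\top\mathbf{u}=0\}$, where $\mathbf{m}^n$ is the vector of (positive) diagonal entries of the lumped mass matrix; then normal velocity equations are understood as posed on $\mathbb{W}_h^n$: the unknown is in $\mathbb{W}_h^n$ and the equation is tested against all vectors of $\mathbb{W}_h^n$ (equivalently, right-hand sides are replaced by $\mathbf{F}-\frac{\mathbf{1}^\top\mathbf{F}}{\mathbf{1}^\top\mathbf{m}^n}\mathbf{m}^n$ and the equation is posed on $\mathbb{W}_h^n$). Fully discrete algebraic system. Find $\mathbf{V}_\nu^{n+1}\in\mathbb{W}_h^n$, $\mathbf{V}_\tau^{n+1}\in\mathbb{R}^N$, $r_{\mathrm g,h}^{n+1},r_{\mathrm m,h}^{n+1},\lambda_{1,h}^{n+1},\dots,\lambda_{K,h}^{n+1}\in\mathbb{R}$ such that $$\mathbf{M}_{\nu,h}^n\mathbf{V}_\nu^{n+1}=-\frac{r_{\mathrm g,h}^{n+1}}{S_{\mathrm g,h}^n}\mathbf{F}_{\mathrm g,h}^n-\sum_{i=1}^K\lambda_{i,h}^{n+1}\mathbf{G}_{i,h}^n,\qquad\mathbf{M}_{\tau,h}^n\mathbf{V}_\tau^{n+1}=-\frac{r_{\mathrm m,h}^{n+1}}{S_{\mathrm m,h}^n}\mathbf{F}_{\mathrm m,h}^n,$$ $$\frac{r_{\mathrm g,h}^{n+1}-r_{\mathrm g,h}^n}{\Delta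 t}=\frac{1}{2S_{\mathrm g,h}^n}(\mathbf{F}_{\mathrm g,h}^n)^\top\mathbf{V}_\nu^{n+1}+\sum_{i=1}^K\frac{\lambda_{i,h}^{n+1}}{2r_{\mathrm g,h}^{n+1}}(\mathbf{G}_{i,h}^n)^\top\mathbf{V}_\nu^{n+1},\qquad\frac{r_{\mathrm m,h}^{n+1}-r_{\mathrm m,h}^n}{\Delta t}=\frac{1}{2S_{\mathrm m,h}^n}(\mathbf{F}_{\mathrm m,h}^n)^\top\mathbf{V}_\tau^{n+1},$$ $$\mathbf{x}_j^{n+1}=\mathbf{x}_j^n+\Delta t\big([\mathbf{V}_\nu^{n+1}]_j\bm{\nu}_j^n+[\mathbf{V}_\tau^{n+1}]_j\bm{\tau}_j^n\big)\ (j=1,\dots,N),\qquad C_i(\bm{\gamma}_h^{n+1})=0\ (i=1,\dots,K),$$ where $\bm{\gamma}_h^{n+1}$ is the closed polygon with vertices $\mathbf{x}_j^{n+1}$. Response vectors. $\mathbf{V}_{\mathrm g,h}^n,\mathbf{V}_{1,h}^n,\dots,\mathbf{V}_{K,h}^n\in\mathbb{W}_h^n$ and $\mathbf{V}_{\mathrm m,h}^n\in\mathbb{R}^N$ are the solutions of $$\mathbf{M}_{\nu,h}^n\mathbf{V}_{\mathrm g,h}^n=-\mathbf{F}_{\mathrm g,h}^n,\qquad\mathbf{M}_{\nu,h}^n\mathbf{V}_{i,h}^n=-\mathbf{G}_{i,h}^n\ (i=1,\dots,K),\qquad\mathbf{M}_{\tau,h}^n\mathbf{V}_{\mathrm m,h}^n=-\mathbf{F}_{\mathrm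 m,h}^n,$$ the normal ones being understood as posed on $\mathbb{W}_h^n$ in the sense above. Reduced system. Let $\widehat r_{\mathrm m}=r_{\mathrm m,h}^n\big/\big(1-\frac{\Delta t}{2(S_{\mathrm m,h}^n)^2}(\mathbf{F}_{\mathrm m,h}^n)^\top\mathbf{V}_{\mathrm m,h}^n\big)$ and $\widehat{\mathbf{V}}_\tau=\frac{\widehat r_{\mathrm m}}{S_{\mathrm m,h}^n}\mathbf{V}_{\mathrm m,h}^n$ (the denominator is at least $1$). For $\bm{\Xi}=(r,\lambda_1,\dots,\lambda_K)^\top\in\mathbb{R}^{K+1}$ with $r\ne0$ put $\mathbf{V}_\nu(\bm{\Xi})=\frac{r}{S_{\mathrm g,h}^n}\mathbf{V}_{\mathrm g,h}^n+\sum_{i=1}^K\lambda_i\mathbf{V}_{i,h}^n$, and let $\bm{\gamma}_h(\bm{\Xi})$ be the closed polygon with vertices $\mathbf{x}_j(\bm{\Xi})=\mathbf{x}_j^n+\Delta t\big([\mathbf{V}_\nu(\bm{\Xi})]_j\bm{\nu}_j^n+[\widehat{\mathbf{V}}_\tau]_j\bm{\tau}_j^n\big)$. Define $\bm{R}(\bm{\Xi})=(R_0(\bm{\Xi}),\dots,R_K(\bm{\Xi}))^\top$ by $$R_0(\bm{\Xi})=\frac{r-r_{\mathrm g,h}^n}{\Delta t}-\frac{1}{2S_{\mathrm g,h}^n}(\mathbf{F}_{\mathrm g,h}^n)^\top\mathbf{V}_\nu(\bm{\Xi})-\sum_{i=1}^K\frac{\lambda_i}{2r}(\mathbf{G}_{i,h}^n)^\top\mathbf{V}_\nu(\bm{\Xi}),\qquad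 R_i(\bm{\Xi})=C_i(\bm{\gamma}_h(\bm{\Xi})),\ i=1,\dots,K.$$ *)

(* Defs.v *)
From HB Require Import structures.
From mathcomp Require Import all_boot all_order all_algebra.
From mathcomp Require Import reals.

Set Implicit Arguments.
Unset Strict Implicit.
Unset Printing Implicit Defensive.

Import Order.TTheory GRing.Theory Num.Theory.
Local Open Scope ring_scope.

Definition dot (R : realType) (N : nat) (u v : 'cV[R]_N) : R :=
  (u^T *m v) 0 0.

Definition sym_posdef_on (R : realType) (N : nat) (W : {pred 'cV[R]_N})
    (M : 'M[R]_N) : Prop :=
  {in W &, forall u v, dot u (M *m v) = dot (M *m u) v} /\
  {in W, forall u, u != 0 -> 0 < dot u (M *m u)}.

Definition sym_possemidef (R : realType) (N : nat) (D : 'M[R]_N) : Prop :=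
  D^T = D /\ forall u : 'cV[R]_N, 0 <= dot u (D *m u).

(* A closed polygon with N vertices in the plane: row j is the vertex x_j, and
   consecutive vertices are joined cyclically. *)
Notation polygon R N := 'M[R]_(N, 2).

Inductive normal_metric := L2_metric | Hm1_metric.

(* The data frozen on the polygon [gamma] of the current time step. *)
Record frozen_data (R : realType) (N K : nat) := FrozenData {
  dt : R;
  gamma : polygon R N;
  tangent : 'M[R]_(N, 2);                 (* row j is tau_j *)
  normal : 'M[R]_(N, 2);                  (* row j is nu_j *)
  metric : normal_metric;
  mass : 'cV[R]_N;                        (* diagonal of the lumped mass matrix *)
  A_nu : 'M[R]_N;
  A_tau : 'M[R]_N;
  D_nu : 'M[R]_N;
  D_tau : 'M[R]_N;
  F_g : 'cV[R]_N;
  F_m : 'cV[R]_N;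
  G : 'I_K -> 'cV[R]_N;
  S_g : R;
  S_m : R;
  constr : 'I_K -> polygon R N -> R;      (* the functionals C_i *)
  r_g : R;
  r_m : R }.

(* The 2 x 2 matrix with rows tau_j and nu_j must be a rotation: (tau_j, nu_j)
   is orthonormal and positively oriented. *)
Record admissible (R : realType) (N K : nat) (d : frozen_data R N K) : Prop :=
  Admissible {
  dt_gt0 : 0 < dt d;
  frame_orthonormal : forall j : 'I_N,
    let Q : 'M[R]_(1 + 1, 2) := col_mx (row j (tangent d)) (row j (normal d)) in
    Q *m Q^T = 1%:M;
  frame_oriented : forall j : 'I_N,
    \det (col_mx (row j (tangent d)) (row j (normal d)) : 'M[R]_2) = 1;
  mass_gt0 : forall j : 'I_N, 0 < mass d j 0;
  D_nu_psd : sym_possemidef (D_nu d);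
  D_tau_psd : sym_possemidef (D_tau d);
  S_g_gt0 : 0 < S_g d;
  S_m_gt0 : 0 < S_m d }.

Definition M_nu (R : realType) (N K : nat) (d : frozen_data R N K) : 'M[R]_N :=
  A_nu d + dt d *: D_nu d.

Definition M_tau (R : realType) (N K : nat) (d : frozen_data R N K) : 'M[R]_N :=
  A_tau d + dt d *: D_tau d.

Definition normal_space (R : realType) (N K : nat) (d : frozen_data R N K) :
    {pred 'cV[R]_N} :=
  [pred u | match metric d with
            | L2_metric => true
            | Hm1_metric => dot (mass d) u == 0
            end].

(* [u] solves the normal velocity equation M_nu u = b.  For the H^{-1} metric
   the unknown lies in the normal velocity space and the equation is tested
   against that space only. *)
Definition normal_eq (R : realType) (N K : nat) (d : frozen_data R N K)
    (u b : 'cV[R]_N) : Prop :=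
  match metric d with
  | L2_metric => M_nu d *m u = b
  | Hm1_metric =>
      u \in normal_space d /\
      {in normal_space d, forall w, dot w (M_nu d *m u) = dot w b}
  end.

Definition moved_polygon (R : realType) (N K : nat) (d : frozen_data R N K)
    (Vnu Vtau : 'cV[R]_N) : polygon R N :=
  \matrix_(j < N)
    (row j (gamma d) +
     dt d *: (Vnu j 0 *: row j (normal d) + Vtau j 0 *: row j (tangent d))).

(* (Vnu, Vtau, rg, rm, lam) are the unknowns at the new time step; the new
   polygon is eliminated through its defining update. *)
Record fully_discrete (R : realType) (N K : nat) (d : frozen_data R N K)
    (Vnu Vtau : 'cV[R]_N) (rg rm : R) (lam : 'cV[R]_K) : Prop := FullyDiscrete {
  fd_space : Vnu \in normal_space d;
  fd_normal :
    normal_eq d Vnu (- (rg / S_g d) *: F_g d - \sum_(i < K) lam i 0 *: G d i);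
  fd_tangential :
    M_tau d *m Vtau = - (rm / S_m d) *: F_m d;
  fd_geometric_energy :
    (rg - r_g d) / dt d =
    1 / (2 * S_g d) * dot (F_g d) Vnu +
    \sum_(i < K) lam i 0 / (2 * rg) * dot (G d i) Vnu;
  fd_mesh_energy :
    (rm - r_m d) / dt d = 1 / (2 * S_m d) * dot (F_m d) Vtau;
  fd_constraints :
    forall i : 'I_K, constr d i (moved_polygon d Vnu Vtau) = 0 }.

Record responses (R : realType) (N K : nat) := Responses {
  V_g : 'cV[R]_N;
  V_c : 'I_K -> 'cV[R]_N;                 (* the constraint responses V_i *)
  V_m : 'cV[R]_N }.

Record is_response (R : realType) (N K : nat) (d : frozen_data R N K)
    (V : responses R N K) : Prop := IsResponse {
  V_g_space : V_g V \in normal_space d;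
  V_g_eq : normal_eq d (V_g V) (- F_g d);
  V_c_space : forall i : 'I_K, V_c V i \in normal_space d;
  V_c_eq : forall i : 'I_K, normal_eq d (V_c V i) (- G d i);
  V_m_eq : M_tau d *m V_m V = - F_m d }.

Definition r_m_hat (R : realType) (N K : nat) (d : frozen_data R N K)
    (V : responses R N K) : R :=
  r_m d / (1 - dt d / (2 * S_m d ^+ 2) * dot (F_m d) (V_m V)).

Definition V_tau_hat (R : realType) (N K : nat) (d : frozen_data R N K)
    (V : responses R N K) : 'cV[R]_N :=
  (r_m_hat d V / S_m d) *: V_m V.

(* The unknown Xi = (r, lambda_1, ..., lambda_K)^T of the reduced system. *)
Definition mkXi (R : realType) (K : nat) (r : R) (lam : 'cV[R]_K) :
    'cV[R]_(1 + K) := col_mx r%:M lam.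
Definition Xi_r (R : realType) (K : nat) (Xi : 'cV[R]_(1 + K)) : R :=
  usubmx Xi 0 0.
Definition Xi_lam (R : realType) (K : nat) (Xi : 'cV[R]_(1 + K)) : 'cV[R]_K :=
  dsubmx Xi.

Definition V_nu_of (R : realType) (N K : nat) (d : frozen_data R N K)
    (V : responses R N K) (Xi : 'cV[R]_(1 + K)) : 'cV[R]_N :=
  (Xi_r Xi / S_g d) *: V_g V + \sum_(i < K) Xi_lam Xi i 0 *: V_c V i.

Definition gamma_of (R : realType) (N K : nat) (d : frozen_data R N K)
    (V : responses R N K) (Xi : 'cV[R]_(1 + K)) : polygon R N :=
  moved_polygon d (V_nu_of d V Xi) (V_tau_hat d V).

(* Only meaningful when Xi_r Xi != 0. *)
Definition residual (R : realType) (N K : nat) (d : frozen_data R N K)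
    (V : responses R N K) (Xi : 'cV[R]_(1 + K)) : 'cV[R]_(1 + K) :=
  let r := Xi_r Xi in
  let lam := Xi_lam Xi in
  let Vnu := V_nu_of d V Xi in
  col_mx
    ((r - r_g d) / dt d - 1 / (2 * S_g d) * dot (F_g d) Vnu
     - \sum_(i < K) lam i 0 / (2 * r) * dot (G d i) Vnu)%:M
    (\col_(i < K) constr d i (gamma_of d V Xi)).

(* Main.v *)
Require Import Defs.
From HB Require Import structures.
From mathcomp Require Import all_boot all_order all_algebra.
From mathcomp Require Import reals ring.
Set Implicit Arguments.
Unset Strict Implicit.
Unset Printing Implicit Defensive.
Import Order.TTheory GRing.Theory Num.Theory.
Local Open Scope ring_scope.

(** Both velocity equations are linear in the right-hand side, and positive
    definiteness makes their solutions unique; hence the velocities are the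
    linear combinations of the response vectors dictated by the right-hand
    sides.  Substituting the tangential velocity turns the mesh energy equation
    into [rm * (1 - dt / (2 S_m^2) F_m^T V_m) = r_m], whose coefficient is at
    least 1 because [F_m^T V_m = - V_m^T M_tau V_m <= 0].  What remains is
    exactly the reduced system. *)

Lemma dotC (R : realType) N (u v : 'cV[R]_N) : dot u v = dot v u.
Proof.
by rewrite /dot !mxE; apply: eq_bigr => i _; rewrite !mxE mulrC.
Qed.

Lemma dotDr (R : realType) N (u v w : 'cV[R]_N) :
  dot u (v + w) = dot u v + dot u w.
Proof. by rewrite /dot mulmxDr mxE. Qed.

Lemma dotZr (R : realType) N (u : 'cV[R]_N) a v : dot u (a *: v) = a * dot u v.
Proof. by rewrite /dot -scalemxAr mxE. Qed.

Lemma dot0r (R : realType) N (u : 'cV[R]_N) : dot u 0 = 0.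
Proof. by rewrite /dot mulmx0 mxE. Qed.

Lemma dotNr (R : realType) N (u v : 'cV[R]_N) : dot u (- v) = - dot u v.
Proof. by rewrite -scaleN1r dotZr mulN1r. Qed.

(** The form in which definiteness yields uniqueness, for the normal equation on its subspace and
    for the tangential one on the whole space. *)
Lemma posdef_dot_eq0 (R : realType) N (W : {pred 'cV[R]_N}) M u :
  sym_posdef_on W M -> u \in W -> dot u (M *m u) = 0 -> u = 0.
Proof.
move=> [_ pos] uW uMu0; apply/eqP/negPn/negP => /(pos u uW).
by rewrite uMu0 ltxx.
Qed.

Section NormalEquation.
Variables (R : realType) (N K : nat) (d : frozen_data R N K).
Implicit Types u v w b c : 'cV[R]_N.

Lemma normal_space0 : 0 \in normal_space d.
Proof. by rewrite inE; case: metric; rewrite // dot0r eqxx. Qed.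

Lemma normal_spaceP a u v : u \in normal_space d -> v \in normal_space d ->
  a *: u + v \in normal_space d.
Proof.
rewrite !inE; case: metric => // /eqP u0 /eqP v0.
by rewrite dotDr dotZr u0 v0 mulr0 addr0.
Qed.

Lemma normal_eq0 : normal_eq d 0 0.
Proof.
rewrite /normal_eq; case E: metric; first by rewrite mulmx0.
by split=> [|w _]; rewrite ?normal_space0 // mulmx0.
Qed.

(** Superposition: for either metric the equation is linear in the pair (unknown, load). *)
Lemma normal_eqP a u v b c : normal_eq d u b -> normal_eq d v c ->
  normal_eq d (a *: u + v) (a *: b + c).
Proof.
rewrite /normal_eq; case E: metric.
  by move=> <- <-; rewrite mulmxDr scalemxAr.
move=> [uW ub] [vW vc]; split=> [|w wW]; first exact: normal_spaceP.
by rewrite mulmxDr -scalemxAr !dotDr !dotZr ub // vc.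
Qed.

Lemma normal_eq_sum (I : finType) (a : I -> R) (u b : I -> 'cV[R]_N) :
  (forall i, normal_eq d (u i) (b i)) ->
  normal_eq d (\sum_i a i *: u i) (\sum_i a i *: b i).
Proof.
move=> ub; apply: (big_ind2 (normal_eq d)) => [|u1 b1 u2 b2 e1 e2|i _].
- exact: normal_eq0.
- by have := normal_eqP 1 e1 e2; rewrite !scale1r.
(* Scaling alone is superposition with the zero solution for the zero load. *)
- by have := normal_eqP (a i) (ub i) normal_eq0; rewrite !addr0.
Qed.

Lemma normal_space_sum (I : finType) (a : I -> R) (u : I -> 'cV[R]_N) :
  (forall i, u i \in normal_space d) ->
  \sum_i a i *: u i \in normal_space d.
Proof.
move=> uW; elim/big_rec: _ => [|i v _ vW]; first exact: normal_space0.
exact: normal_spaceP.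
Qed.

(** The tested form is common to both metrics, so uniqueness needs no case split on the metric. *)
Lemma normal_eq_weak u b : normal_eq d u b ->
  {in normal_space d, forall w, dot w (M_nu d *m u) = dot w b}.
Proof. by rewrite /normal_eq; case: metric => [<- | []]. Qed.

(** The difference of two solutions lies in the space, hence is a legitimate test vector; tested
    against itself, the load cancels and its energy vanishes. *)
Lemma normal_eq_uniq u v b : sym_posdef_on (normal_space d) (M_nu d) ->
  u \in normal_space d -> v \in normal_space d ->
  normal_eq d u b -> normal_eq d v b -> u = v.
Proof.
move=> Mpos uW vW ub vb.
have uvW : - 1 *: v + u \in normal_space d by exact: normal_spaceP.
apply/eqP; rewrite -subr_eq0 addrC -scaleN1r; apply/eqP.
apply: (posdef_dot_eq0 Mpos uvW).
rewrite mulmxDr -scalemxAr dotDr dotZr.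
by rewrite (normal_eq_weak ub) // (normal_eq_weak vb) // mulN1r addNr.
Qed.

End NormalEquation.

Lemma posdef_mulmx_inj (R : realType) N (M : 'M[R]_N) :
  sym_posdef_on predT M -> injective (fun u : 'cV[R]_N => M *m u).
Proof.
move=> Mpos u v Muv; apply/eqP; rewrite -subr_eq0; apply/eqP.
by apply: (posdef_dot_eq0 Mpos); rewrite // mulmxBr Muv subrr dot0r.
Qed.

Section Responses.
Variables (R : realType) (N K : nat) (d : frozen_data R N K).
Variable V : responses R N K.
Hypothesis V_response : is_response d V.

(** Takes [r] and [lam] separately rather than stacked, to match the velocity formula of the full
    system. *)
Let V_nu r (lam : 'cV[R]_K) : 'cV[R]_N :=
  (r / S_g d) *: V_g V + \sum_(i < K) lam i 0 *: V_c V i.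

Lemma response_combination_space r lam : V_nu r lam \in normal_space d.
Proof.
apply: normal_spaceP; first exact: V_g_space V_response.
exact: normal_space_sum (V_c_space V_response).
Qed.

Lemma response_combination_eq r lam :
  normal_eq d (V_nu r lam)
    (- (r / S_g d) *: F_g d - \sum_(i < K) lam i 0 *: G d i).
Proof.
(* The minus signs move from the coefficients onto the loads, where the response equations carry
   them. *)
rewrite scaleNr -scalerN -sumrN.
under [in X in normal_eq _ _ X]eq_bigr => i _ do rewrite -scalerN.
apply: normal_eqP; first exact: V_g_eq V_response.
exact: normal_eq_sum (V_c_eq V_response).
Qed.

Lemma V_nu_of_mkXi r lam : V_nu_of d V (mkXi r lam) = V_nu r lam.
Proof.
by rewrite /V_nu_of /Xi_r /Xi_lam /mkXi col_mxKu col_mxKd mxE eqxx mulr1n.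
Qed.

(** The top block is the geometric energy equation with its right-hand side moved over; the lower
    block collects the constraints. *)
Lemma residual_eq0P r lam :
  residual d V (mkXi r lam) = 0 <->
  (r - r_g d) / dt d =
    1 / (2 * S_g d) * dot (F_g d) (V_nu r lam) +
    \sum_(i < K) lam i 0 / (2 * r) * dot (G d i) (V_nu r lam) /\
  forall i, constr d i (moved_polygon d (V_nu r lam) (V_tau_hat d V)) = 0.
Proof.
rewrite /residual /gamma_of V_nu_of_mkXi /Xi_r /Xi_lam /mkXi col_mxKu col_mxKd.
rewrite !mxE eqxx mulr1n; split.
  rewrite -col_mx0 => /eq_col_mx[/matrixP/(_ 0 0) R0 /matrixP RC].
  move: R0; rewrite !mxE eqxx mulr1n => /eqP; rewrite -addrA -opprD subr_eq0.
  by move=> /eqP ->; split=> // i; have := RC i 0; rewrite !mxE.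
move=> [-> RC]; rewrite -addrA -opprD subrr -col_mx0.
by congr col_mx; apply/matrixP => i j; rewrite !mxE ?mul0rn // RC.
Qed.

Lemma mesh_denominator_ge1 : admissible d -> sym_posdef_on predT (M_tau d) ->
  1 <= 1 - dt d / (2 * S_m d ^+ 2) * dot (F_m d) (V_m V).
Proof.
move=> adm [_ Mpos]; rewrite lerDl oppr_ge0; apply: mulr_ge0_le0.
  apply: divr_ge0; first exact: ltW (dt_gt0 adm).
  exact: mulr_ge0 (ler0n _ 2) (sqr_ge0 _).
rewrite -[F_m d]opprK -(V_m_eq V_response) dotC dotNr oppr_le0.
(* Definiteness speaks of nonzero vectors only, so a vanishing mesh response is treated apart. *)
have [-> | V0] := eqVneq (V_m V) 0; first by rewrite mulmx0 dot0r.
exact/ltW/Mpos.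
Qed.

Lemma mesh_energy_eqP rm : admissible d -> sym_posdef_on predT (M_tau d) ->
  (rm - r_m d) / dt d =
    1 / (2 * S_m d) * dot (F_m d) ((rm / S_m d) *: V_m V) <->
  rm = r_m_hat d V.
Proof.
move=> adm Mpos; have den1 := mesh_denominator_ge1 adm Mpos.
have den0 := lt0r_neq0 (lt_le_trans ltr01 den1).
have dt0 := lt0r_neq0 (dt_gt0 adm); have S0 := lt0r_neq0 (S_m_gt0 adm).
rewrite dotZr /r_m_hat; set a := dot _ _ in den0 *.
(* The defect of the mesh energy equation is an affine function of [rm], divided by [dt d]; both
   implications read off its unique zero. *)
have key : (rm - r_m d) / dt d - 1 / (2 * S_m d) * (rm / S_m d * a)
   = (rm * (1 - dt d / (2 * S_m d ^+ 2) * a) - r_m d) / dt d.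
  by field; rewrite S0 dt0.
split=> [e | rm_eq].
  apply/(canRL (mulfK den0))/eqP; rewrite -subr_eq0.
  by move/eqP: e; rewrite -subr_eq0 key mulf_eq0 invr_eq0 (negbTE dt0) orbF.
by apply/eqP; rewrite -subr_eq0 key rm_eq divfK // subrr mul0r.
Qed.

End Responses.

Theorem mainTheorem4 (R : realType) (N K : nat) (d : frozen_data R N K)
    (V : responses R N K)
    (d_admissible : admissible d)
    (M_nu_posdef : sym_posdef_on (normal_space d) (M_nu d))
    (M_tau_posdef : sym_posdef_on predT (M_tau d))
    (V_response : is_response d V) :
  (forall (r : R) (lam : 'cV[R]_K),
     r != 0 -> residual d V (mkXi r lam) = 0 ->
     let rg1 := r in
     let rm1 :=
       r_m d / (1 - dt d / (2 * S_m d ^+ 2) * dot (F_m d) (V_m V)) in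
     let Vtau1 := (rm1 / S_m d) *: V_m V in
     let Vnu1 := (rg1 / S_g d) *: V_g V + \sum_(i < K) lam i 0 *: V_c V i in
     fully_discrete d Vnu1 Vtau1 rg1 rm1 lam)
  /\
  (forall (Vnu1 Vtau1 : 'cV[R]_N) (rg1 rm1 : R) (lam1 : 'cV[R]_K),
     fully_discrete d Vnu1 Vtau1 rg1 rm1 lam1 -> rg1 != 0 ->
     residual d V (mkXi rg1 lam1) = 0).
Proof.
have tau_eq rm : M_tau d *m ((rm / S_m d) *: V_m V) = - (rm / S_m d) *: F_m d.
  by rewrite -scalemxAr (V_m_eq V_response) scalerN scaleNr.
split=> [r lam r0 /residual_eq0P[energy cons] rg1 rm1 Vtau1 Vnu1 | ].
  (* The geometric energy and constraint equations are exactly what the vanishing residual gives. *)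
  split=> //.
  - exact: response_combination_space.
  - exact: response_combination_eq.
  - exact: tau_eq.
  - exact/(mesh_energy_eqP V_response _ d_admissible M_tau_posdef).
move=> Vnu Vtau rg rm lam [Vspace Vnormal Vtan energy mesh cons] _.
have Vnu_eq : Vnu = (rg / S_g d) *: V_g V + \sum_(i < K) lam i 0 *: V_c V i.
  apply: (normal_eq_uniq M_nu_posdef Vspace _ Vnormal).
  - exact: response_combination_space.
  - exact: response_combination_eq.
have Vtau_eq : Vtau = (rm / S_m d) *: V_m V.
  by apply: (posdef_mulmx_inj M_tau_posdef); rewrite Vtan tau_eq.
(* The mesh energy equation now involves [rm] as its only unknown. *)
rewrite Vtau_eq in mesh cons.
have rm_eq : rm = r_m_hat d V.
  exact/(mesh_energy_eqP V_response _ d_admissible M_tau_posdef).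
apply/residual_eq0P; rewrite -Vnu_eq; split=> // i.
(* With [rm] identified, the tangential velocities, and hence the two new polygons, coincide. *)
by rewrite /V_tau_hat -rm_eq.
Qed.
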